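(* Let $F$ be a field, $D\in \mathrm{Der}_{\mathbb Z}(F)$ an absolute derivation, and $V_2$ a $2$-dimensional $F$-vector space with a fixed volume form. Then the square $$\begin{array}{ccc} C_4(2) & \xrightarrow{\;d\;} & C_3(2)\\ {\scriptstyle\tau^2_1}\downarrow & & \downarrow{\scriptstyle\tau^2_0}\\ \beta^D_2(F) & \xrightarrow{\;\partial^D\;} & F\otimes F^\times\end{array}$$ is commutative (modulo $2$-torsion), i.e. $\tau^2_0\circ d=\partial^D\circ\tau^2_1$ on $C_4(2)$.
   Context: All tensor products are over $\mathbb Z$; $F\otimes F^\times$ is an $F$-vector space via the left factor. $F^{\bullet\bullet}=F\setminus\{0,1\}$. A derivation $D\in\mathrm{Der}_{\mathbb Z}(F)$ is an additive map $D:F\to F$ with $D(ab)=aD(b)+bD(a)$; $D\log a:=D(a)/a$. All identities are understood modulo $2$-torsion. The space $\beta_2(F)$: $F[F^{\bullet\bullet}]$ (the $F$-vector space with basis $[a]$, $a\in F^{\bullet\bullet}$) modulo the kernel of the $F$-linear map $F[F^{\bullet\bullet}]\to F\otimes F^\times$, $[a]\mapsto a\otimes a+(1-a)\otimes(1-a)$; $\langle a\rangle_2$ is the class of $[a]$. Put $\llbracket a\rrbracket^D_2=\frac{D(a)}{a(1-a)}\langle a\rangle_2$, and let $\beta^D_2(F)\subset\beta_2(F)$ be the $F$-subspace generated by all $\llbracket a\rrbracket^D_2$, $a\in F^{\bullet\bullet}$. The $F$-linear map $\partial^D:\beta^D_2(F)\to F\otimes F^\times$ is $\partial^D(\llbracket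 a\rrbracket^D_2)=-D\log(1-a)\otimes a+D\log(a)\otimes(1-a)$. Configurations: $C_m(2)$ is the free abelian group generated by $m$-tuples of vectors $(l_0,\ldots,l_{m-1})$ in $V_2$ in generic position (any $2$ or fewer of them are linearly independent), modulo the diagonal action of $GL(V_2)$. $d(l_0,\ldots,l_{m-1})=\sum_{i=0}^{m-1}(-1)^i(l_0,\ldots,\hat l_i,\ldots,l_{m-1})$. With $\omega\in\det V_2^*$ the volume form, $\Delta(l_i,l_j)=\langle\omega,l_i\wedge l_j\rangle$. The maps: $$\tau_0^2(l_0,l_1,l_2)=\sum_{i=0}^2\Big(D\log\Delta(l_i,l_{i+2})\otimes\Delta(l_i,l_{i+1})-D\log\Delta(l_{i+1},l_i)\otimes\Delta(l_i,l_{i+2})\Big)\quad(\text{indices mod }3),$$ $$\tau_1^2(l_0,\ldots,l_3)=\llbracket r(l_0,\ldots,l_3)\rrbracket^D_2,\qquad r(l_0,\ldots,l_3)=\frac{\Delta(l_0,l_3)\Delta(l_1,l_2)}{\Delta(l_0,l_2)\Delta(l_1,l_3)}.$$ *)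

(* Defs.v *)
From HB Require Import structures.
From mathcomp Require Import all_boot all_order all_algebra.
From mathcomp Require Import ring boolp freeg.

Set Implicit Arguments.
Unset Strict Implicit.
Unset Printing Implicit Defensive.

Import GRing.Theory.
Local Open Scope ring_scope.
Local Open Scope quotient_scope.

Section ZSpan.
Variables (M : zmodType) (S : M -> Prop).

Definition zspan : {pred M} := fun x =>
  `[< forall P : {pred M},
        zmod_closed P -> (forall y, S y -> y \in P) -> x \in P >].

Lemma zspanP x : reflect (forall P : {pred M},
  zmod_closed P -> (forall y, S y -> y \in P) -> x \in P) (x \in zspan).
Proof. exact: asboolP. Qed.

Lemma mem_zspan x : S x -> x \in zspan.
Proof. by move=> Sx; apply/zspanP => P _; apply. Qed.

Lemma zspan_zmod_closed : zmod_closed zspan.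
Proof.
split; first by apply/zspanP => P [].
move=> x y /zspanP Hx /zspanP Hy; apply/zspanP => P cP SP.
by case: (cP) => _; apply; [apply: Hx | apply: Hy].
Qed.

HB.instance Definition _ := GRing.isZmodClosed.Build M zspan zspan_zmod_closed.

End ZSpan.

Section FSpan.
Variables (F : fieldType) (M : lmodType F) (S : M -> Prop).

Definition fspan : {pred M} := fun x =>
  `[< forall P : {pred M},
        submod_closed P -> (forall y, S y -> y \in P) -> x \in P >].

Lemma fspanP x : reflect (forall P : {pred M},
  submod_closed P -> (forall y, S y -> y \in P) -> x \in P) (x \in fspan).
Proof. exact: asboolP. Qed.

Lemma mem_fspan x : S x -> x \in fspan.
Proof. by move=> Sx; apply/fspanP => P _; apply. Qed.

Lemma fspan_submod_closed : submod_closed fspan.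
Proof.
split; first by apply/fspanP => P [].
move=> c x y /fspanP Hx /fspanP Hy; apply/fspanP => P cP SP.
by case: (cP) => _; apply; [apply: Hx | apply: Hy].
Qed.

HB.instance Definition _ :=
  GRing.isSubmodClosed.Build F M fspan fspan_submod_closed.

End FSpan.

Section ZLift.
Variables (K : choiceType) (M : zmodType) (f : K -> M).

Definition zlift (x : {freeg K}) : M :=
  fglift (f : K -> zmodule M) x.

Lemma zlift_is_zmod_morphism : zmod_morphism zlift.
Proof. exact: (@lift_is_additive _ _ (zmodule M) f). Qed.

HB.instance Definition _ :=
  GRing.isZmodMorphism.Build {freeg K} M zlift zlift_is_zmod_morphism.

Lemma zliftU n k : zlift << n *g k >> = f k *~ n.
Proof. exact: (@liftU _ (zmodule M) K f). Qed.

Lemma zliftU1 k : zlift << k >> = f k.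
Proof. by rewrite zliftU. Qed.

Lemma zlift_zspan (S : {freeg K} -> Prop) :
  (forall x, S x -> zlift x = 0) -> {in zspan S, forall x, zlift x = 0}.
Proof.
move=> S0 x /zspanP /(_ [pred y | zlift y == 0]) Hx.
apply/eqP/Hx => [|y /S0 /eqP //].
split=> [|y z]; rewrite !inE ?raddf0 // => /eqP y0 /eqP z0.
by rewrite raddfB /= y0 z0 subr0.
Qed.

End ZLift.

Lemma freeg_zmod_ext (K : choiceType) (M : zmodType)
    (f g : {additive {freeg K} -> M}) :
  (forall k, f << k >> = g << k >>) -> f =1 g.
Proof.
move=> fg x; rewrite -[x]freeg_sumE !raddf_sum; apply: eq_bigr => k _.
rewrite -[coeff k x]intz -freegU_mulz !raddfMz; congr (_ *~ _); exact: fg.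
Qed.

Section Tensor.
Variables A B : zmodType.

Inductive tensor_rel : {freeg (A * B)%type} -> Prop :=
| TensorDl a a' b :
    tensor_rel (<< (a + a', b) >> - << (a, b) >> - << (a', b) >>)
| TensorDr a b b' :
    tensor_rel (<< (a, b + b') >> - << (a, b) >> - << (a, b') >>).

Definition tensor : Type := {ideal_quot (zspan tensor_rel)}.
HB.instance Definition _ := GRing.Zmodule.on tensor.

Definition tens (a : A) (b : B) : tensor :=
  \pi_({ideal_quot (zspan tensor_rel)}) << (a, b) >>.

Lemma tensDl a a' b : tens (a + a') b = tens a b + tens a' b.
Proof.
transitivity (\pi_({ideal_quot (zspan tensor_rel)}) (<< (a, b) >> + << (a', b) >>)).
  apply/eqP; rewrite -Quotient.idealrBE opprD addrA.
  exact/mem_zspan/TensorDl.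
exact: raddfD.
Qed.

Lemma tensDr a b b' : tens a (b + b') = tens a b + tens a b'.
Proof.
transitivity (\pi_({ideal_quot (zspan tensor_rel)}) (<< (a, b) >> + << (a, b') >>)).
  apply/eqP; rewrite -Quotient.idealrBE opprD addrA.
  exact/mem_zspan/TensorDr.
exact: raddfD.
Qed.

Section Lift.
Variables (M : zmodType) (f : A -> B -> M).
Hypothesis fDl : forall a a' b, f (a + a') b = f a b + f a' b.
Hypothesis fDr : forall a b b', f a (b + b') = f a b + f a b'.

Definition tensor_lift (x : tensor) : M :=
  zlift (fun ab : A * B => f ab.1 ab.2) (repr x).

Lemma tensor_lift_pi x :
  tensor_lift (\pi_({ideal_quot (zspan tensor_rel)}) x)
  = zlift (fun ab : A * B => f ab.1 ab.2) x.
Proof.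
apply/eqP; rewrite -subr_eq0 -raddfB; apply/eqP.
apply: (zlift_zspan (S := tensor_rel)).
  by move=> _ [] *; rewrite !raddfB /= !zliftU1 /= ?fDl ?fDr addrAC addrK subrr.
by rewrite Quotient.idealrBE reprK.
Qed.

Lemma tensor_lift_is_zmod_morphism : zmod_morphism tensor_lift.
Proof.
elim/quotW=> x; elim/quotW=> y.
by rewrite -[X in tensor_lift X]raddfB !tensor_lift_pi raddfB.
Qed.

Lemma tensor_liftE a b : tensor_lift (tens a b) = f a b.
Proof. by rewrite tensor_lift_pi zliftU1. Qed.

End Lift.

Lemma tensor_ext (M : zmodType) (f g : {additive tensor -> M}) :
  (forall a b, f (tens a b) = g (tens a b)) -> f =1 g.
Proof.
move=> fg; elim/quotW=> x.
pose p : {additive {freeg (A * B)%type} -> tensor} :=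
  \pi_({ideal_quot (zspan tensor_rel)}).
apply: (freeg_zmod_ext (f := f \o p) (g := g \o p)) => -[a b]; exact: fg.
Qed.

End Tensor.

Section TensorLmod.
Variables (R : nzRingType) (A : lmodType R) (B : zmodType).

Definition tensor_scale (c : R) : tensor A B -> tensor A B :=
  tensor_lift (fun a b => tens (c *: a) b).

Let scDl c (a a' : A) (b : B) :
  tens (c *: (a + a')) b = tens (c *: a) b + tens (c *: a') b.
Proof. by rewrite scalerDr tensDl. Qed.

Let scDr c (a : A) (b b' : B) :
  tens (c *: a) (b + b') = tens (c *: a) b + tens (c *: a) b'.
Proof. by rewrite tensDr. Qed.

HB.instance Definition _ c :=
  GRing.isZmodMorphism.Build (tensor A B) (tensor A B) (tensor_scale c)
    (tensor_lift_is_zmod_morphism (scDl c) (scDr c)).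

Lemma tensor_scaleE c a b : tensor_scale c (tens a b) = tens (c *: a) b.
Proof. exact: tensor_liftE (scDl c) (scDr c) a b. Qed.

Lemma tensor_scaleA c c' x :
  tensor_scale c (tensor_scale c' x) = tensor_scale (c * c') x.
Proof.
apply: (tensor_ext (f := tensor_scale c \o tensor_scale c')) => a b /=.
by rewrite !tensor_scaleE scalerA.
Qed.

Lemma tensor_scale1 : left_id 1 tensor_scale.
Proof.
by apply: (tensor_ext (g := idfun)) => a b /=; rewrite tensor_scaleE scale1r.
Qed.

Lemma tensor_scaleDr : right_distributive tensor_scale +%R.
Proof. by move=> c x y; rewrite raddfD. Qed.

Lemma tensor_scaleDl x :
  {morph (fun c => tensor_scale c x) : c c' / c + c'}.
Proof.
move=> c c'.
apply: (tensor_ext (g := tensor_scale c \+ tensor_scale c')) => a b /=.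
by rewrite !tensor_scaleE scalerDl tensDl.
Qed.

HB.instance Definition _ := GRing.Zmodule_isLmodule.Build R (tensor A B)
  tensor_scaleA tensor_scale1 tensor_scaleDr tensor_scaleDl.

Lemma scale_tens c (a : A) (b : B) : c *: tens a b = tens (c *: a) b.
Proof. exact: tensor_scaleE. Qed.

End TensorLmod.

(* The multiplicative group of F, written additively: the zmodType sum is the *)
(* product of F.                                                              *)
Record units (F : fieldType) := Units { unit_val :> F; _ : unit_val != 0 }.

Section Units.
Variable F : fieldType.
Local Notation U := (units F).

HB.instance Definition _ := [isSub for @unit_val F].
HB.instance Definition _ := [Choice of U by <:].

Lemma unit_val_neq0 (u : U) : val u != 0. Proof. by case: u. Qed.

Lemma unit_mul_subproof (u v : U) : val u * val v != 0.
Proof. by rewrite mulf_neq0 ?unit_val_neq0. Qed.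
Lemma unit_inv_subproof (u : U) : (val u)^-1 != 0.
Proof. by rewrite invr_eq0 unit_val_neq0. Qed.

Definition unit_one : U := Units (oner_neq0 F).
Definition unit_mul u v : U := Units (unit_mul_subproof u v).
Definition unit_inv u : U := Units (unit_inv_subproof u).

Lemma unit_mulA : associative unit_mul.
Proof. by move=> u v w; apply: val_inj; rewrite /= mulrA. Qed.
Lemma unit_mulC : commutative unit_mul.
Proof. by move=> u v; apply: val_inj; rewrite /= mulrC. Qed.
Lemma unit_mul1 : left_id unit_one unit_mul.
Proof. by move=> u; apply: val_inj; rewrite /= mul1r. Qed.
Lemma unit_mulV : left_inverse unit_one unit_inv unit_mul.
Proof. by move=> u; apply: val_inj; rewrite /= mulVf ?unit_val_neq0. Qed.

HB.instance Definition _ :=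
  GRing.isZmodule.Build U unit_mulA unit_mulC unit_mul1 unit_mulV.

(* Total on F; the default value is only reached at 0.                        *)
Definition to_units (x : F) : U := insubd unit_one x.

Lemma to_unitsK x : x != 0 -> val (to_units x) = x.
Proof. by move=> x0; rewrite /to_units val_insubd x0. Qed.

Lemma to_unitsM x y :
  x != 0 -> y != 0 -> to_units (x * y) = to_units x + to_units y.
Proof. by move=> x0 y0; apply: val_inj; rewrite /= !to_unitsK ?mulf_neq0. Qed.

Lemma to_units1 : to_units 1 = 0.
Proof. by apply: val_inj; rewrite to_unitsK ?oner_neq0. Qed.

End Units.

Notation FtensU F := (tensor F^o (units F)).

(* a \ot x is the tensor of a and x in F (x) F^*, for x nonzero.              *)
Definition tensF (F : fieldType) (a x : F) : FtensU F :=
  tens (a : F^o) (to_units x).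
Notation "a \ot x" := (tensF a x) (at level 45, no associativity) : ring_scope.

Section TensF.
Variable F : fieldType.
Implicit Types a x : F.

Lemma tensFDl a b x : (a + b) \ot x = a \ot x + b \ot x.
Proof. exact: tensDl. Qed.

Lemma tensFM a x y : x != 0 -> y != 0 -> a \ot (x * y) = a \ot x + a \ot y.
Proof. by move=> x0 y0; rewrite /tensF to_unitsM // tensDr. Qed.

Lemma scale_tensF c a x : c *: (a \ot x) = (c * a) \ot x.
Proof. exact: scale_tens. Qed.

Lemma tensF1 a : a \ot 1 = 0.
Proof. by apply: (addIr (a \ot 1)); rewrite add0r -tensFM ?oner_neq0 ?mulr1. Qed.

Lemma tensFN1 a : a \ot (-1) = 0.
Proof.
have N1 : -1 != 0 :> F by rewrite oppr_eq0 oner_neq0.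
have [two0|two0] := eqVneq (2 : F) 0.
  suff -> : -1 = 1 :> F by apply: tensF1.
  by apply/esym/eqP; rewrite -subr_eq0 opprK; apply/eqP.
rewrite -[a](divfK two0) mulr_natr mulr2n tensFDl -tensFM //.
by rewrite mulrNN mulr1 tensF1.
Qed.

Lemma tensFN a x : x != 0 -> a \ot (- x) = a \ot x.
Proof.
move=> x0; rewrite -mulN1r tensFM ?oppr_eq0 ?oner_neq0 //.
by rewrite tensFN1 add0r.
Qed.

End TensF.

Record derivation (F : fieldType) := Derivation {
  der_fun :> F -> F;
  derD : forall a b, der_fun (a + b) = der_fun a + der_fun b;
  derM : forall a b, der_fun (a * b) = a * der_fun b + b * der_fun a
}.

Definition dlog (F : fieldType) (D : derivation F) (a : F) : F := D a / a.

Section DLog.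
Variables (F : fieldType) (D : derivation F).

Lemma der1 : D 1 = 0.
Proof.
by apply: (addIr (D 1)); rewrite add0r -[RHS](congr1 D (mulr1 1)) derM mul1r.
Qed.

Lemma der0 : D 0 = 0.
Proof. by apply: (addIr (D 0)); rewrite -derD !add0r. Qed.

Lemma derN a : D (- a) = - D a.
Proof. by apply: (addIr (D a)); rewrite -derD !addNr der0. Qed.

Lemma dlogN a : dlog D (- a) = dlog D a.
Proof. by rewrite /dlog derN invrN mulrNN. Qed.

Lemma dlogM a b : a != 0 -> b != 0 -> dlog D (a * b) = dlog D a + dlog D b.
Proof.
by move=> a0 b0; rewrite /dlog derM; field; rewrite a0 b0.
Qed.

End DLog.

Record Fbb (F : fieldType) :=
  FBB { Fbb_val :> F; _ : (Fbb_val != 0) && (Fbb_val != 1) }.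

Section Beta2.
Variable F : fieldType.

HB.instance Definition _ := [isSub for @Fbb_val F].
HB.instance Definition _ := [Choice of Fbb F by <:].

Lemma Fbb_neq0 (a : Fbb F) : val a != 0. Proof. by have /andP[] := valP a. Qed.
Lemma Fbb_neq1 (a : Fbb F) : 1 - val a != 0.
Proof. by have /andP[_] := valP a; rewrite subr_eq0 eq_sym. Qed.

Definition delta2 (x : {freeg (Fbb F) / F}) : FtensU F :=
  fglift (fun a : Fbb F =>
    (a : F) \ot (a : F) + (1 - (a : F)) \ot (1 - (a : F))) x.

Lemma delta2U c a : delta2 << c *g a >> =
  c *: ((a : F) \ot (a : F) + (1 - (a : F)) \ot (1 - (a : F))).
Proof. exact: liftU. Qed.

Lemma delta2_is_zmod_morphism : zmod_morphism delta2.
Proof. exact: lift_is_additive. Qed.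
HB.instance Definition _ :=
  GRing.isZmodMorphism.Build {freeg (Fbb F) / F} (FtensU F) delta2
    delta2_is_zmod_morphism.

Lemma freegUZ (K : choiceType) (c d : F) (k : K) :
  c *: << d *g k >> = << c * d *g k >>.
Proof. by apply/eqP/freeg_eqP=> x; rewrite coeffZ !coeffU mulrA. Qed.

Lemma delta2_is_scalable : scalable delta2.
Proof.
move=> c x; rewrite -[x]freeg_sumE scaler_sumr !raddf_sum.
by apply: eq_bigr => a _; rewrite freegUZ /= !delta2U scalerA.
Qed.
HB.instance Definition _ :=
  GRing.isScalable.Build F {freeg (Fbb F) / F} (FtensU F) *:%R delta2
    delta2_is_scalable.

Definition beta2_ker : {pred {freeg (Fbb F) / F}} := fun x => delta2 x == 0.

Lemma beta2_ker_zmod_closed : zmod_closed beta2_ker.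
Proof.
split=> [|x y]; rewrite !unfold_in ?raddf0 // => /eqP x0 /eqP y0.
by rewrite raddfB /= x0 y0 subr0.
Qed.
HB.instance Definition _ :=
  GRing.isZmodClosed.Build {freeg (Fbb F) / F} beta2_ker beta2_ker_zmod_closed.

Definition beta2 : Type := {ideal_quot beta2_ker}.
HB.instance Definition _ := GRing.Zmodule.on beta2.

Local Notation pi2 := (\pi_({ideal_quot beta2_ker})).

Lemma beta2W (P : beta2 -> Prop) : (forall x, P (pi2 x)) -> forall x, P x.
Proof. by move=> Ppi x; rewrite -[x]reprK; apply: Ppi. Qed.

Definition beta2_scale (c : F) (x : beta2) : beta2 := pi2 (c *: repr x).

Lemma beta2_scale_pi c x : beta2_scale c (pi2 x) = pi2 (c *: x).
Proof.
apply/eqP; rewrite -Quotient.idealrBE -scalerBr unfold_in linearZ /=.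
have: repr (pi2 x) - x \in beta2_ker by rewrite Quotient.idealrBE reprK.
by rewrite unfold_in => /eqP ->; rewrite scaler0.
Qed.

Lemma beta2_scaleA c c' x :
  beta2_scale c (beta2_scale c' x) = beta2_scale (c * c') x.
Proof. by elim/beta2W: x => x; rewrite !beta2_scale_pi scalerA. Qed.
Lemma beta2_scale1 : left_id 1 beta2_scale.
Proof. by elim/beta2W=> x; rewrite beta2_scale_pi scale1r. Qed.
Lemma beta2_scaleDr : right_distributive beta2_scale +%R.
Proof.
move=> c; elim/beta2W=> x; elim/beta2W=> y.
rewrite -[X in beta2_scale c X](raddfD pi2).
by rewrite !beta2_scale_pi scalerDr raddfD.
Qed.
Lemma beta2_scaleDl x : {morph (fun c => beta2_scale c x) : c c' / c + c'}.
Proof.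
move=> c c'; elim/beta2W: x => x.
by rewrite !beta2_scale_pi scalerDl raddfD.
Qed.
HB.instance Definition _ := GRing.Zmodule_isLmodule.Build F beta2
  beta2_scaleA beta2_scale1 beta2_scaleDr beta2_scaleDl.

Definition bra2 (a : Fbb F) : beta2 := pi2 << a >>.

Variable D : derivation F.

Definition braD2_in_beta2 (a : Fbb F) : beta2 :=
  (D a / ((a : F) * (1 - (a : F)))) *: bra2 a.

Definition betaD2_pred : {pred beta2} :=
  fspan (fun x => exists a : Fbb F, x = braD2_in_beta2 a).
HB.instance Definition _ := GRing.SubmodClosed.on betaD2_pred.

Record betaD2 := BetaD2 { betaD2_val :> beta2; _ : betaD2_val \in betaD2_pred }.
HB.instance Definition _ := [isSub for betaD2_val].
HB.instance Definition _ := [Choice of betaD2 by <:].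
HB.instance Definition _ := [SubChoice_isSubLmodule of betaD2 by <:].

Lemma braD2_subproof a : braD2_in_beta2 a \in betaD2_pred.
Proof. by apply: mem_fspan; exists a. Qed.

Definition braD2 (a : Fbb F) : betaD2 := BetaD2 (braD2_subproof a).

Definition delta_beta2 (x : beta2) : FtensU F := delta2 (repr x).

Lemma delta_beta2_pi x : delta_beta2 (pi2 x) = delta2 x.
Proof.
apply/eqP; rewrite -subr_eq0 -raddfB.
change (repr (pi2 x) - x \in beta2_ker).
by rewrite Quotient.idealrBE reprK.
Qed.

Lemma delta_beta2_is_linear : linear delta_beta2.
Proof.
move=> c; elim/beta2W=> x; elim/beta2W=> y.
have -> : c *: (pi2 x : beta2) + pi2 y = pi2 (c *: x + y).
  by rewrite [RHS]raddfD /= -beta2_scale_pi.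
by rewrite !delta_beta2_pi linearP.
Qed.

Definition is_partialD (f : betaD2 -> FtensU F) :=
  forall a : Fbb F, f (braD2 a) =
    - (dlog D (1 - (a : F)) \ot (a : F)) + dlog D a \ot (1 - (a : F)).

HB.instance Definition _ :=
  GRing.isLinear.Build F beta2 (FtensU F) *:%R delta_beta2 delta_beta2_is_linear.

Lemma partialD_exists : exists f : {linear betaD2 -> FtensU F}, is_partialD f.
Proof.
exists (delta_beta2 \o val : {linear betaD2 -> FtensU F}) => a /=.
have a0 := Fbb_neq0 a; have a1 := Fbb_neq1 a.
rewrite /braD2_in_beta2 linearZ /= delta_beta2_pi delta2U scale1r scalerDr.
rewrite !scale_tensF; congr (_ + _); last first.
  by congr (_ \ot _); rewrite /dlog; field; rewrite a0 a1.
rewrite -scaleN1r scale_tensF; congr (_ \ot _).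
by rewrite /dlog derD der1 derN; field; rewrite a0 a1.
Qed.

Lemma partialD_unique (f g : {linear betaD2 -> FtensU F}) :
  is_partialD f -> is_partialD g -> f =1 g.
Proof.
move=> fP gP x.
pose P : {pred beta2} := fun y => `[< exists2 z, val z = y & f z = g z >].
suff /asboolP[z /val_inj <- //] : val x \in P.
have /fspanP := valP x; apply => [|_ [a ->]]; last first.
  by apply/asboolP; exists (braD2 a); rewrite ?fP ?gP.
split=> [|c y1 y2]; first by apply/asboolP; exists 0; rewrite ?raddf0 ?linear0.
move=> /asboolP[z1 <- e1] /asboolP[z2 <- e2]; apply/asboolP.
by exists (c *: z1 + z2); rewrite ?linearP //= e1 e2.
Qed.

(* The map is unique by partialD_unique.                                      *)
Definition partialD : {linear betaD2 -> FtensU F} := sval (cid partialD_exists).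

Lemma partialDE : is_partialD partialD.
Proof. exact: svalP (cid partialD_exists). Qed.

End Beta2.

(* Nonzero alternating bilinear forms stand for nonzero elements of det V^*,  *)
(* omega u v being the pairing of omega with the wedge product of u and v.    *)
Record volume_form (F : fieldType) (V : vectType F) := VolumeForm {
  vol_form :> {biscalar V};
  vol_alt : forall v, vol_form v v = 0;
  vol_neq0 : exists u v, vol_form u v != 0
}.

Section VolumeForm.
Variables (F : fieldType) (V : vectType F).
Hypothesis dimV : \dim {:V} = 2%N.
Variable omega : volume_form V.

Lemma volDl u v w : omega (u + v) w = omega u w + omega v w.
Proof. exact: linearDl. Qed.
Lemma volDr u v w : omega u (v + w) = omega u v + omega u w.
Proof. exact: linearDr. Qed.
Lemma volZl c u v : omega (c *: u) v = c * omega u v.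
Proof. exact: linearZl_LR. Qed.
Lemma volZr c u v : omega u (c *: v) = c * omega u v.
Proof. exact: linearZr_LR. Qed.

Lemma vol_anti u v : omega u v = - omega v u.
Proof.
have := vol_alt omega (u + v).
rewrite volDl !volDr !vol_alt add0r addr0 => /eqP.
by rewrite addr_eq0 => /eqP.
Qed.

Lemma vol_coord : exists (e : V * V) (x y : V -> F), forall u v,
  (u = x u *: e.1 + y u *: e.2) /\
  (forall g : 'End(V),
    omega (g u) (g v) = (x u * y v - y u * x v) * omega (g e.1) (g e.2)).
Proof.
have := fun v => @coord_vbasis F V v fullv (memvf v).
move: (vbasis {:V}); rewrite dimV => e eE.
pose x := coord e 0; pose y := coord e 1.
have uE u : u = x u *: e`_0 + y u *: e`_1.
  rewrite {1}[u]eE big_ord_recl big_ord1 /x /y.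
  by congr (_ + coord e _ u *: _); apply/val_inj.
exists (e`_0, e`_1), x, y => u v; split=> //= g.
rewrite {1}[u]uE {1}[v]uE !(linearD g) !(linearZ_LR g) /=.
rewrite volDl !volDr !volZl !volZr !vol_alt.
rewrite [omega (g e`_1) _]vol_anti; ring.
Qed.

Lemma vol_plucker a b c d :
  omega a b * omega c d - omega a c * omega b d + omega a d * omega b c = 0.
Proof.
have [e [x [y E]]] := vol_coord.
have [k {}E] : exists k, forall u v, omega u v = (x u * y v - y u * x v) * k.
  by exists (omega e.1 e.2) => u v; have := (E u v).2 \1%VF; rewrite !id_lfunE.
by rewrite !E; ring.
Qed.

Lemma vol_det (g : 'End(V)) :
  exists delta, forall u v, omega (g u) (g v) = delta * omega u v.
Proof.
have [e [x [y E]]] := vol_coord.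
have E1 u v : omega u v = (x u * y v - y u * x v) * omega e.1 e.2.
  by have := (E u v).2 \1%VF; rewrite !id_lfunE.
exists (omega (g e.1) (g e.2) / omega e.1 e.2) => u v.
rewrite (E u v).2 [omega u v]E1.
have e0 : omega e.1 e.2 != 0.
  have [a [b]] := vol_neq0 omega; apply: contraNneq => e0.
  by rewrite E1 e0 mulr0.
by field.
Qed.

Lemma vol_free u v : free [:: u; v] -> omega u v != 0.
Proof.
move=> uv; have [a [b]] := vol_neq0 omega; apply: contraNneq => uv0.
have full : <<[:: u; v]>>%VS = {:V}%VS.
  by apply/eqP; rewrite eqEdim subvf /= dimV (eqP uv).
have inE w : exists c : F * F, w = c.1 *: u + c.2 *: v.
  have : w \in <<[tuple u; v]>>%VS by rewrite full memvf.
  move=> /coord_span ->; eexists (_, _); rewrite big_ord_recl big_ord1 /=.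
  reflexivity.
have [ca ->] := inE a; have [cb ->] := inE b.
rewrite volDl !volDr !volZl !volZr !vol_alt.
by rewrite [omega v u]vol_anti uv0 oppr0 !mulr0 !addr0.
Qed.

End VolumeForm.

Section Configurations.
Variables (F : fieldType) (V : vectType F).

Definition generic2 m (l : m.-tuple V) : bool :=
  [forall s : {set 'I_m}, (#|s| <= 2)%N ==> free [seq tnth l i | i <- enum s]].

Record gtuple m := GTuple { gtuple_val :> m.-tuple V; _ : generic2 gtuple_val }.
HB.instance Definition _ m := [isSub for @gtuple_val m].
HB.instance Definition _ m := [Choice of gtuple m by <:].

Lemma generic2P m (l : m.-tuple V) :
  reflect (forall s : {set 'I_m}, (#|s| <= 2)%N ->
             free [seq tnth l i | i <- enum s])
          (generic2 l).
Proof. by apply: (iffP forallP) => H s; apply/implyP/H. Qed.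

Lemma gtuple_free m (l : gtuple m) (i j : 'I_m) :
  i != j -> free [:: tnth l i; tnth l j].
Proof.
move=> ij; have /forallP /(_ [set i; j]) := valP l.
rewrite cards2 ij /=; congr is_true; apply: perm_free.
rewrite perm_sym -[[:: tnth l i; _]]/(map (tnth l) [:: i; j]) perm_map //.
apply: uniq_perm; rewrite /= ?enum_uniq ?inE ?andbT //.
by move=> k; rewrite mem_enum !inE.
Qed.

(* (l_0, .., l_{m-1}) and (g l_0, .., g l_{m-1}) are identified for g in      *)
(* GL(V), i.e. for g an injective endomorphism of the finite-dimensional V.   *)
Inductive config_rel m : {freeg (gtuple m)} -> Prop :=
| ConfigRel (g : 'End(V)) (l l' : gtuple m) of lker g == 0%VS
    & (forall i, tnth l' i = g (tnth l i)) :
    config_rel (<< l' >> - << l >>).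

Definition config m : Type := {ideal_quot (zspan (@config_rel m))}.
HB.instance Definition _ m := GRing.Zmodule.on (config m).

Definition conf m (l : gtuple m) : config m :=
  \pi_({ideal_quot (zspan (@config_rel m))}) << l >>.

Definition GL_invariant m (M : Type) (f : gtuple m -> M) :=
  forall (g : 'End(V)) (l l' : gtuple m), lker g == 0%VS ->
    (forall i, tnth l' i = g (tnth l i)) -> f l' = f l.

Section Lift.
Variables (m : nat) (M : zmodType) (f : gtuple m -> M).

Definition config_lift_fun of GL_invariant f := fun x : config m =>
  zlift f (repr x).

Hypothesis finv : GL_invariant f.

Lemma config_lift_pi x :
  config_lift_fun finv (\pi_({ideal_quot (zspan (@config_rel m))}) x)
  = zlift f x.
Proof.
apply/eqP; rewrite -subr_eq0 -raddfB; apply/eqP.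
apply: (zlift_zspan (S := @config_rel m)); last first.
  by rewrite Quotient.idealrBE reprK.
move=> _ [g l l' g0 E]; rewrite raddfB /= !zliftU1.
by rewrite (finv g0 E) subrr.
Qed.

Lemma config_lift_is_zmod_morphism : zmod_morphism (config_lift_fun finv).
Proof.
move=> x y; rewrite -[x]reprK -[y]reprK -[X in config_lift_fun _ X]raddfB.
by rewrite !config_lift_pi raddfB.
Qed.

HB.instance Definition _ := GRing.isZmodMorphism.Build (config m) M
  (config_lift_fun finv) config_lift_is_zmod_morphism.

Definition config_lift : {additive config m -> M} := config_lift_fun finv.

Lemma config_liftE l : config_lift (conf l) = f l.
Proof. by rewrite /config_lift /= config_lift_pi zliftU1. Qed.

End Lift.

Lemma config_ext m (M : zmodType) (f g : {additive config m -> M}) :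
  (forall l, f (conf l) = g (conf l)) -> f =1 g.
Proof.
move=> fg x; rewrite -[x]reprK.
pose p : {additive {freeg (gtuple m)} -> config m} :=
  \pi_({ideal_quot (zspan (@config_rel m))}).
apply: (freeg_zmod_ext (f := f \o p) (g := g \o p)); exact: fg.
Qed.

Definition face_tuple m (i : 'I_m.+1) (l : m.+1.-tuple V) : m.-tuple V :=
  [tuple tnth l (fintype.lift i j) | j < m].

Lemma face_generic m (i : 'I_m.+1) (l : gtuple m.+1) :
  generic2 (face_tuple i l).
Proof.
apply/forallP => s; apply/implyP => s2.
have /forallP /(_ (fintype.lift i @: s)) := valP l.
rewrite (card_imset _ (@lift_inj _ i)) s2 /=; congr is_true; apply: perm_free.
rewrite perm_sym.
rewrite (eq_map (g := tnth l \o fintype.lift i)); last first.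
  by move=> j; rewrite tnth_mktuple.
rewrite map_comp perm_map //; apply: uniq_perm.
- by rewrite map_inj_uniq ?enum_uniq //; apply: lift_inj.
- exact: enum_uniq.
move=> k; rewrite mem_enum; apply/mapP/imsetP => -[j]; rewrite ?mem_enum => *;
  by exists j; rewrite ?mem_enum.
Qed.

Definition face m (i : 'I_m.+1) (l : gtuple m.+1) : gtuple m :=
  GTuple (face_generic i l).

Definition bdry_gen m (l : gtuple m.+1) : config m :=
  \sum_(i < m.+1) conf (face i l) *~ (-1) ^+ i.

Lemma conf_eq m (g : 'End(V)) (l l' : gtuple m) : lker g == 0%VS ->
  (forall i, tnth l' i = g (tnth l i)) -> conf l' = conf l.
Proof.
move=> g0 E; apply/eqP; rewrite -Quotient.idealrBE.
exact/mem_zspan/(ConfigRel g0).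
Qed.

Lemma bdry_gen_inv m : GL_invariant (@bdry_gen m).
Proof.
move=> g l l' g0 E; apply: eq_bigr => i _; congr (_ *~ _).
by apply: (conf_eq g0) => j; rewrite !tnth_mktuple E.
Qed.

Definition bdry m : {additive config m.+1 -> config m} :=
  config_lift (@bdry_gen_inv m).

Lemma bdryE m (l : gtuple m.+1) : bdry m (conf l) = bdry_gen l.
Proof. exact: config_liftE. Qed.

End Configurations.

Section Tau.
Variables (F : fieldType) (D : derivation F) (V : vectType F).
Hypothesis dimV : \dim {:V} = 2%N.
Variable omega : volume_form V.

Definition Delta m (l : m.-tuple V) (i j : 'I_m) : F :=
  omega (tnth l i) (tnth l j).

Lemma Delta_opp m (l : m.-tuple V) i j : Delta l j i = - Delta l i j.
Proof. exact: vol_anti. Qed.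

Lemma Delta_neq0 m (l : gtuple V m) i j : i != j -> Delta l i j != 0.
Proof. by move=> ij; apply: vol_free => //; apply: gtuple_free. Qed.

Lemma Delta_GL m (g : 'End(V)) (l l' : gtuple V m.+2) :
  (forall i, tnth l' i = g (tnth l i)) ->
  exists2 d, d != 0 & forall i j, Delta l' i j = d * Delta l i j.
Proof.
move=> E; have [d dE] := vol_det dimV omega g.
have dD i j : Delta l' i j = d * Delta l i j by rewrite /Delta !E dE.
exists d => //; have : Delta l' 0 1 != 0 by apply: Delta_neq0.
by rewrite dD mulf_eq0 negb_or => /andP[].
Qed.

(* i + 1 and i + 2 are taken in the ring 'I_3, i.e. modulo 3.                 *)
Definition tau0_gen (l : gtuple V 3) : FtensU F :=
  \sum_(i < 3) (dlog D (Delta l i (i + 2)) \ot Delta l i (i + 1)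
                - dlog D (Delta l (i + 1) i) \ot Delta l i (i + 2)).

Lemma tau0_gen_inv : GL_invariant tau0_gen.
Proof.
move=> g l l' _ E; have [d d0 dE] := Delta_GL E.
have N i j : i != j -> Delta l i j != 0 by apply: Delta_neq0.
have ne1 (i : 'I_3) : i != i + 1 by case: i => [[|[|[|]]]].
have ne2 (i : 'I_3) : i != i + 2 by case: i => [[|[|[|]]]].
have step i : dlog D (Delta l' i (i + 2)) \ot Delta l' i (i + 1)
                - dlog D (Delta l' (i + 1) i) \ot Delta l' i (i + 2)
  = (dlog D (Delta l i (i + 2)) \ot Delta l i (i + 1)
                - dlog D (Delta l (i + 1) i) \ot Delta l i (i + 2))
  + (dlog D d \ot Delta l i (i + 1) - dlog D d \ot Delta l i (i + 2)
     + (dlog D (Delta l i (i + 2)) \ot d - dlog D (Delta l (i + 1) i) \ot d)).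
  have n1 : i + 1 != i by rewrite eq_sym.
  rewrite !dE !dlogM ?N // !tensFM ?N // !tensFDl.
  move: (dlog D d \ot d) => z; rewrite !opprD !addrA.
  by rewrite (ACl (4*8*3*7*2*6*(1*5)))%AC /= subrr addr0.
rewrite /tau0_gen (eq_bigr _ (fun i _ => step i)) big_split /=.
rewrite [X in _ + X](_ : _ = 0) ?addr0 // !big_ord_recl big_ord0.
have -> : ord0 = 0 :> 'I_3 by [].
have -> : fintype.lift 0 ord0 = 1 :> 'I_3 by apply: val_inj.
have -> : fintype.lift 0 (fintype.lift ord0 ord0) = 2 :> 'I_3 by apply: val_inj.
have -> : 1 + 1 = 2 :> 'I_3 by apply: val_inj.
have -> : 1 + 2 = 0 :> 'I_3 by apply: val_inj.
have -> : 2 + 1 = 0 :> 'I_3 by apply: val_inj.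
have -> : 2 + 2 = 1 :> 'I_3 by apply: val_inj.
rewrite !add0r addr0 !(Delta_opp l 0) !(Delta_opp l 1 2) !dlogN !tensFN ?N //.
rewrite !addrA (ACl (1*6*2*9*5*10*3*12*4*7*8*11))%AC /=.
by rewrite subrr add0r addNr add0r subrr add0r subrr add0r addNr add0r addNr.
Qed.

Definition tau0 : {additive config V 3 -> FtensU F} := config_lift tau0_gen_inv.

Lemma tau0E l : tau0 (conf l) = tau0_gen l.
Proof. exact: config_liftE. Qed.

Definition crossratio_val (l : 4.-tuple V) : F :=
  (Delta l 0 3 * Delta l 1 2) / (Delta l 0 2 * Delta l 1 3).

Lemma crossratio_subproof (l : gtuple V 4) :
  (crossratio_val l != 0) && (crossratio_val l != 1).
Proof.
have N i j : i != j -> Delta l i j != 0 by apply: Delta_neq0.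
rewrite /crossratio_val mulf_neq0 ?invr_eq0 ?mulf_neq0 ?N //=.
have := vol_plucker dimV omega (tnth l 0) (tnth l 1) (tnth l 2) (tnth l 3).
rewrite -!/(Delta _ _ _) => P; apply/eqP => r1.
have /eqP := mulf_neq0 (N 0 1 isT) (N 2 3 isT); apply.
have {r1} E : Delta l 0 3 * Delta l 1 2 = Delta l 0 2 * Delta l 1 3.
  by rewrite -[LHS](divfK (mulf_neq0 (N 0 2 isT) (N 1 3 isT))) r1 mul1r.
by move: P; rewrite E subrK.
Qed.

Definition crossratio (l : gtuple V 4) : Fbb F := FBB (crossratio_subproof l).

Definition tau1_gen (l : gtuple V 4) : betaD2 D := braD2 D (crossratio l).

Lemma tau1_gen_inv : GL_invariant tau1_gen.
Proof.
move=> g l l' g0 E; congr braD2; apply: val_inj => /=.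
have [d d0 dE] := Delta_GL E.
have N i j : i != j -> Delta l i j != 0 by apply: Delta_neq0.
by rewrite /crossratio_val !dE; field; rewrite d0 !N.
Qed.

Definition tau1 : {additive config V 4 -> betaD2 D} := config_lift tau1_gen_inv.

Lemma tau1E l : tau1 (conf l) = tau1_gen l.
Proof. exact: config_liftE. Qed.

End Tau.

Definition eq_mod_2torsion (M : zmodType) (x y : M) := (x - y) *+ 2 = 0.

(* Main.v *)
Require Import Defs.
From mathcomp Require Import all_boot all_algebra.

Set Implicit Arguments.
Unset Strict Implicit.
Unset Printing Implicit Defensive.

Import GRing.Theory.
Local Open Scope ring_scope.

(** Write [Dij] for [Delta l_i l_j] and [x ∧ y] for [Dlog x ⊗ y - Dlog y ⊗ x].
    This pairing is alternating, turns products into sums and ignores signs, so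
    that the square commutes without any torsion error. Both of its sides are
    cyclic sums [c x y z = x ∧ y + y ∧ z + z ∧ x]: the map [tau0] sends a triple
    to [c D01 D12 D02], while [x/z ∧ y/z = c x y z] and the Pluecker relation
    send the cross-ratio to [c (D12 D03) (D23 D01) (D13 D02)]. Attach [Dij] to
    the edge [ij] of a tetrahedron: the last expression pairs opposite edges,
    and two edges that are not opposite lie in exactly one common face, so
    expanding the products gives the sum of [c] over the four oriented faces. *)

Section SmallSums.
Variable M : nmodType.

Lemma sum_ord3 (f : 'I_3 -> M) : \sum_i f i = f 0 + f 1 + f 2.
Proof.
rewrite !big_ord_recr big_ord0 /= add0r.
by congr (f _ + f _ + f _); apply: val_inj.
Qed.

Lemma sum_ord4 (f : 'I_4 -> M) : \sum_i f i = f 0 + f 1 + f 2 + f 3.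
Proof.
rewrite big_ord_recr sum_ord3 /=.
by congr (f _ + f _ + f _ + f _); apply: val_inj.
Qed.

End SmallSums.

Section CyclicSum.
Variables (T : Type) (M : zmodType) (w : T -> T -> M).

Definition cyclic_sum x y z : M := w x y + w y z + w z x.

Lemma cyclic_sum_rot x y z : cyclic_sum y z x = cyclic_sum x y z.
Proof. by rewrite /cyclic_sum [LHS]addrC addrA. Qed.

Hypothesis w_anti : forall x y, w x y = - w y x.

Lemma cyclic_sum_rev x y z : cyclic_sum z y x = - cyclic_sum x y z.
Proof. by rewrite /cyclic_sum !opprD -!w_anti [w z y + _]addrC. Qed.

End CyclicSum.

Section MultiplicativePairing.
Variables (F : fieldType) (M : zmodType) (w : F -> F -> M).
Implicit Types x y z : F.
Hypothesis w_anti : forall x y, w x y = - w y x.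
Hypothesis wMl : forall x y z, x != 0 -> y != 0 -> w (x * y) z = w x z + w y z.

Let wMr x y z : y != 0 -> z != 0 -> w x (y * z) = w x y + w x z.
Proof. by move=> y0 z0; rewrite !(w_anti x) wMl // opprD. Qed.

(* The right-hand side sums over the faces of a tetrahedron whose pairs of    *)
(* opposite edges are labelled (x, x'), (y, y') and (z, z').                  *)
Lemma cyclic_sumM x x' y y' z z' :
    x != 0 -> x' != 0 -> y != 0 -> y' != 0 -> z != 0 -> z' != 0 ->
  cyclic_sum w (x * x') (y * y') (z * z')
  = cyclic_sum w x y z + cyclic_sum w x' y z'
    + cyclic_sum w x' y' z + cyclic_sum w x y' z'.
Proof.
move=> *; rewrite /cyclic_sum !wMl ?mulf_neq0 // !wMr // !addrA.
by rewrite [LHS](ACl (1*5*9*3*6*12*4*7*10*2*8*11))%AC.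
Qed.

Hypothesis wxx : forall x, w x x = 0.

Lemma cyclic_sum_div x y z : x != 0 -> y != 0 -> z != 0 ->
  w (x / z) (y / z) = cyclic_sum w x y z.
Proof.
move=> x0 y0 z0; have [a0 b0] : x / z != 0 /\ y / z != 0.
  by rewrite !mulf_neq0 ?invr_eq0.
rewrite -[in RHS](divfK z0 x) -[in RHS](divfK z0 y).
move: (x / z) (y / z) a0 b0 => a b a0 b0.
rewrite /cyclic_sum !wMl ?wMr ?mulf_neq0 // !wxx !addr0 !(w_anti z).
by rewrite addrNK addrK.
Qed.

End MultiplicativePairing.

Section DlogWedge.
Variables (F : fieldType) (D : derivation F).
Implicit Types x y z : F.

Definition dlog_wedge x y : FtensU F := dlog D x \ot y - dlog D y \ot x.
Local Notation "x ∧ y" := (dlog_wedge x y) (at level 45, no associativity).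

Lemma dlog_wedge_anti x y : x ∧ y = - (y ∧ x).
Proof. by rewrite /dlog_wedge opprB. Qed.

Lemma dlog_wedgexx x : x ∧ x = 0.
Proof. exact: subrr. Qed.

Lemma dlog_wedgeNl x y : (- x) ∧ y = x ∧ y.
Proof.
have [->|x0] := eqVneq x 0; first by rewrite oppr0.
by rewrite /dlog_wedge dlogN tensFN.
Qed.

Lemma dlog_wedgeNr x y : x ∧ (- y) = x ∧ y.
Proof. by rewrite !(dlog_wedge_anti x) dlog_wedgeNl. Qed.

Lemma dlog_wedgeMl x y z : x != 0 -> y != 0 -> (x * y) ∧ z = x ∧ z + y ∧ z.
Proof.
by move=> x0 y0; rewrite /dlog_wedge dlogM // tensFDl tensFM // opprD addrACA.
Qed.

Lemma partialD_braD2 (a : Fbb F) : partialD D (braD2 D a) = val a ∧ (1 - val a).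
Proof. by rewrite partialDE addrC. Qed.

End DlogWedge.

Section Square.
Variables (F : fieldType) (D : derivation F) (V : vectType F).
Hypothesis dimV : \dim {:V} = 2%N.
Variable omega : volume_form V.

Lemma bdry_conf4 (l : gtuple V 4) :
  bdry V 3 (conf l)
  = conf (face 0 l) - conf (face 1 l) + conf (face 2 l) - conf (face 3 l).
Proof.
rewrite bdryE /bdry_gen sum_ord4 /= !exprS expr0 !mulr1 !mulN1r !opprK.
by rewrite !mulr1z !mulrN1z.
Qed.

Lemma Delta_face m (i : 'I_m.+1) (l : gtuple V m.+1) j k :
  Delta omega (face i l) j k
  = Delta omega l (fintype.lift i j) (fintype.lift i k).
Proof. by rewrite /Delta !tnth_mktuple. Qed.

Lemma compl_crossratio (l : gtuple V 4) (d := Delta omega l) :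
  1 - crossratio_val omega l = (d 0 1 * d 2 3) / (d 0 2 * d 1 3).
Proof.
have plucker : d 0 1 * d 2 3 = d 0 2 * d 1 3 - d 0 3 * d 1 2.
  apply/eqP; rewrite -subr_eq0 opprB addrA addrAC.
  exact/eqP/(vol_plucker dimV omega).
by rewrite plucker mulrBl divff // mulf_neq0 ?Delta_neq0.
Qed.

Local Notation cyclic_wedge := (cyclic_sum (dlog_wedge D)).

Lemma tau0_genE (l : gtuple V 3) (d := Delta omega l) :
  tau0_gen D omega l = cyclic_wedge (d 0 1) (d 1 2) (d 0 2).
Proof.
have tau0_term i j k : dlog D (d i k) \ot d i j - dlog D (d j i) \ot d i k
    = dlog_wedge D (d i k) (d i j).
  by rewrite /d (Delta_opp _ _ i j) dlogN.
rewrite /tau0_gen (eq_bigr _ (fun i _ => tau0_term i _ _)) sum_ord3.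
have [-> -> -> ->] : [/\ 1 + 1 = 2 :> 'I_3, 1 + 2 = 0 :> 'I_3,
    2 + 1 = 0 :> 'I_3 & 2 + 2 = 1 :> 'I_3] by split; apply: val_inj.
rewrite !add0r /d (Delta_opp _ l 0 1) (Delta_opp _ l 0 2) (Delta_opp _ l 1 2).
by rewrite !(dlog_wedgeNl, dlog_wedgeNr) cyclic_sum_rot.
Qed.

Lemma tau0_face (l : gtuple V 4) (i a b c : 'I_4) (d := Delta omega l) :
  fintype.lift i 0 = a -> fintype.lift i 1 = b -> fintype.lift i 2 = c ->
  tau0 D dimV omega (conf (face i l)) = cyclic_wedge (d a b) (d b c) (d a c).
Proof. by move=> <- <- <-; rewrite tau0E tau0_genE !Delta_face. Qed.

Lemma tau0_bdry_conf (l : gtuple V 4) (d := Delta omega l) :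
  tau0 D dimV omega (bdry V 3 (conf l))
  = cyclic_wedge (d 1 2) (d 2 3) (d 1 3) - cyclic_wedge (d 0 2) (d 2 3) (d 0 3)
    + cyclic_wedge (d 0 1) (d 1 3) (d 0 3)
    - cyclic_wedge (d 0 1) (d 1 2) (d 0 2).
Proof.
rewrite bdry_conf4 raddfB raddfD raddfB.
by congr (_ - _ + _ - _); apply: tau0_face; apply: val_inj.
Qed.

Lemma partialD_crossratio (l : gtuple V 4) (d := Delta omega l) :
  partialD D (braD2 D (crossratio dimV omega l))
  = cyclic_wedge (d 1 2 * d 0 3) (d 2 3 * d 0 1) (d 1 3 * d 0 2).
Proof.
rewrite partialD_braD2 /= compl_crossratio /crossratio_val -/d.
rewrite (cyclic_sum_div (dlog_wedge_anti D) (@dlog_wedgeMl _ D) (dlog_wedgexx D))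
  ?mulf_neq0 ?Delta_neq0 //.
by rewrite (mulrC (d 0 3)) (mulrC (d 0 1)) (mulrC (d 0 2)).
Qed.

Lemma tau_square_commutes (x : config V 4) :
  tau0 D dimV omega (bdry V 3 x) = partialD D (tau1 D dimV omega x).
Proof.
apply: (config_ext (f := tau0 D dimV omega \o bdry V 3)
  (g := partialD D \o tau1 D dimV omega)) => l /=.
rewrite tau1E partialD_crossratio tau0_bdry_conf.
rewrite (cyclic_sumM (dlog_wedge_anti D) (@dlog_wedgeMl _ D)) ?Delta_neq0 //.
rewrite -!(cyclic_sum_rev (dlog_wedge_anti D)).
congr (_ + _ + _ + _); first exact: cyclic_sum_rot.
by rewrite -cyclic_sum_rot.
Qed.

End Square.

Theorem proposition3p3 (F : fieldType) (D : derivation F) (V : vectType F)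
  (dimV : \dim {:V} = 2%N) (omega : volume_form V) (x : config V 4) :
  eq_mod_2torsion (tau0 D dimV omega (bdry V 3 x))
                  (partialD D (tau1 D dimV omega x)).
Proof.
by rewrite /eq_mod_2torsion tau_square_commutes subrr mul0rn.
Qed.
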